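(* The generalized discrete Riccati operator $F$ is non-expansive: $\operatorname{Lip}(F;S^n_{++})\leq 1$. Let $$\begin{pmatrix}B\\ D\end{pmatrix}=\begin{pmatrix}\bar B\\ \bar D\end{pmatrix}W$$ be a rank factorization. Then a necessary and sufficient condition to have $\operatorname{Lip}(F;S^n_{++})<1$ is that there is a matrix $S$ such that $$\begin{pmatrix}A\\ C\end{pmatrix}=\begin{pmatrix}\bar B\\ \bar D\end{pmatrix}S.$$ In that case, $$\operatorname{Lip}(F;S^n_{++})\leq\frac{M(S'\bar RS/Q)}{\big(1+\sqrt{1+M(S'\bar RS/Q)}\big)^2}<1,\qquad\text{where }\bar R=(WR^{-1}W')^{-1}.$$
   Context: $S^n$ is the set of real symmetric $n\times n$ matrices, $S^n_{++}$ the positive definite ones; $\leq$ is the Loewner order; $'$ denotes transpose. For $X\in S^n$, $Y\in S^n_{++}$, $M(X/Y)=\inf\{t\in\mathbb{R}:X\leq tY\}$, and the Thompson metric on $S^n_{++}$ is $d_T(X,Y)=\log\max\{M(X/Y),M(Y/X)\}$. $A,C\in\mathbb{R}^{n\times n}$, $B,D\in\mathbb{R}^{n\times m}$, and $Q\in S^n$, $R\in S^m$ are positive definite. The operator $F$ is $$F(P)=A'PA+C'PC+Q-(B'PA+D'PC)'(R+B'PB+D'PD)^{-1}(B'PA+D'PC),$$ which maps $S^n_{++}$ to itself, and $\operatorname{Lip}(F;S^n_{++})=\sup_{P_1\neq P_2\in S^n_{++}}d_T(F(P_1),F(P_2))/d_T(P_1,P_2)$. In a rank factorization, the first factor $\begin{pmatrix}\bar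 B\\ \bar D\end{pmatrix}$ has full column rank and $W$ has full row rank. *)

(* Defs.v *)
From mathcomp Require Import all_boot all_order all_algebra.
From mathcomp Require Import all_classical all_reals all_analysis.

Set Implicit Arguments.
Unset Strict Implicit.
Unset Printing Implicit Defensive.

Import Order.TTheory GRing.Theory Num.Theory.

Local Open Scope classical_set_scope.
Local Open Scope ring_scope.

Definition psd_set (K : realType) (n : nat) : set 'M[K]_n :=
  [set X | X^T = X /\ forall x : 'cV[K]_n, 0 <= (x^T *m X *m x) 0 0].

Definition pd_set (K : realType) (n : nat) : set 'M[K]_n :=
  [set X | X^T = X /\
           forall x : 'cV[K]_n, x != 0 -> 0 < (x^T *m X *m x) 0 0].

Definition loewner_le (K : realType) (n : nat) (X Y : 'M[K]_n) : Prop :=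
  psd_set (Y - X).

(* [inf] is the real-valued infimum, equal to 0 on sets that are empty or not
   bounded below; for X symmetric, Y positive definite and 0 < n the set is
   nonempty and bounded below. *)
Definition M_ratio (K : realType) (n : nat) (X Y : 'M[K]_n) : K :=
  inf [set t : K | loewner_le X (t *: Y)].

Definition thompson (K : realType) (n : nat) (X Y : 'M[K]_n) : K :=
  ln (Num.max (M_ratio X Y) (M_ratio Y X)).

(* The supremum is taken in the extended reals, so no finiteness is assumed. *)
Definition Lip (K : realType) (n : nat)
    (F : 'M[K]_n -> 'M[K]_n) (D : set 'M[K]_n) : \bar K :=
  ereal_sup [set r : \bar K | exists P1 P2 : 'M[K]_n,
    [/\ D P1, D P2, P1 <> P2 &
        r = (thompson (F P1) (F P2) / thompson P1 P2)%:E]].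

Definition riccati (K : realType) (n m : nat)
    (A C : 'M[K]_n) (B D : 'M[K]_(n, m)) (Q : 'M[K]_n) (R : 'M[K]_m)
    (P : 'M[K]_n) : 'M[K]_n :=
  let G := B^T *m P *m A + D^T *m P *m C in
  A^T *m P *m A + C^T *m P *m C + Q
    - G^T *m invmx (R + B^T *m P *m B + D^T *m P *m D) *m G.

(* [row_full L] says that the rank of L is its number of columns, i.e. that
   L has full column rank; [row_free W] that W has full row rank. *)
Definition rank_factorization (K : fieldType) (p m r : nat)
    (X : 'M[K]_(p, m)) (L : 'M[K]_(p, r)) (W : 'M[K]_(r, m)) : Prop :=
  [/\ X = L *m W, row_full L & row_free W].

(* Main.v *)
Require Import Defs.
From mathcomp Require Import all_boot all_order all_algebra.
From mathcomp Require Import all_classical all_reals all_analysis.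
From mathcomp Require Import ring lra.

(** The whole argument rests on the variational form of the operator:
    completing the square shows that
    x' F(P) x = min_u [(Ax + Bu)' P (Ax + Bu) + (Cx + Du)' P (Cx + Du)
                       + x' Q x + u' R u]
    (lemma [stage_cost_square]).  Bounding F(P1) from above by the cost of a
    well chosen u, and F(P2) from below by its optimal cost, turns any
    inequality P1 <= t P2 into an inequality between F(P1) and F(P2).

    Such inequalities are all that the Thompson metric needs: if P1 <= t P2
    with 1 <= t always implies F(P1) <= t^k F(P2), then Lip(F) <= k
    ([Lip_le]).  Using the control that is optimal for P2 gives k = 1, because
    the P-dependent part of the cost is multiplied by at most t and the part
    x'Qx + u'Ru, which is nonnegative, is unchanged.

    Under the range condition (A; C) = (Bb; Db) S, put y = S x and v = - W u.
    Minimizing u'Ru over the fibres of W leaves the weight Rb, so that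
    x' F(P) x = x'Qx + min_v [(y - v)' N (y - v) + v' Rb v]
    with N = Bb'P Bb + Db'P Db, that is, F(P) = Q + S' (N : Rb) S with N : Rb
    the parallel sum.  Let v0 be optimal for N and let z in [0, 1] be the ratio
    of the minimum to rho = y' Rb y.  Replacing N by t N, a suitable point of
    the segment from y to v0 shows that the new minimum is at most
    rho t z / (1 + (t - 1) z), which is what happens for positive scalars
    ([parallel_sum_scaling]).  Since rho <= mu x'Qx, the estimate is reduced to
    the contraction rate of a one-dimensional Moebius map
    ([moebius_contraction]), whose logarithmic derivative has supremum
    (s - 1) / (s + 1) = mu / (1 + s)^2, where s = sqrt (1 + mu).

    Conversely, if the range of (A; C) is not contained in that of (B; D),
    there is a vector x such that (A; C) x stays at positive distance from the
    range of (B; D); then x' F(t I) x grows at least linearly in t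
    ([not_range_growth]), the Thompson distance of F(t I) and F(I) is at least
    ln t + b for a constant b, and its quotient by the distance ln t of t I
    and I has lower limit at least 1 ([growth_Lip_ge1]). *)

Set Implicit Arguments.
Unset Strict Implicit.
Unset Printing Implicit Defensive.

Import Order.TTheory GRing.Theory Num.Theory.

Local Open Scope classical_set_scope.
Local Open Scope ring_scope.

(** * Bilinear forms *)

Definition bform (K : realType) (p q : nat) (X : 'M[K]_(p, q))
  (u : 'cV[K]_p) (v : 'cV[K]_q) : K := (u^T *m X *m v) 0 0.

Section BilinearForms.
Context {K : realType}.
Implicit Types p q r : nat.

Lemma bformDl p q (X : 'M[K]_(p, q)) u1 u2 v :
  bform X (u1 + u2) v = bform X u1 v + bform X u2 v.
Proof. by rewrite /bform linearD /= !mulmxDl mxE. Qed.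

Lemma bformDr p q (X : 'M[K]_(p, q)) u v1 v2 :
  bform X u (v1 + v2) = bform X u v1 + bform X u v2.
Proof. by rewrite /bform mulmxDr mxE. Qed.

Lemma bformZl p q (X : 'M[K]_(p, q)) a u v :
  bform X (a *: u) v = a * bform X u v.
Proof. by rewrite /bform linearZ /= -!scalemxAl mxE. Qed.

Lemma bformZr p q (X : 'M[K]_(p, q)) a u v :
  bform X u (a *: v) = a * bform X u v.
Proof. by rewrite /bform -!scalemxAr mxE. Qed.

Lemma bformNl p q (X : 'M[K]_(p, q)) u v : bform X (- u) v = - bform X u v.
Proof. by rewrite -scaleN1r bformZl mulN1r. Qed.

Lemma bformNr p q (X : 'M[K]_(p, q)) u v : bform X u (- v) = - bform X u v.
Proof. by rewrite -scaleN1r bformZr mulN1r. Qed.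

Lemma bformD p q (X Y : 'M[K]_(p, q)) u v :
  bform (X + Y) u v = bform X u v + bform Y u v.
Proof. by rewrite /bform mulmxDr mulmxDl mxE. Qed.

Lemma bformN p q (X : 'M[K]_(p, q)) u v : bform (- X) u v = - bform X u v.
Proof. by rewrite /bform mulmxN mulNmx mxE. Qed.

Lemma bformZ p q (X : 'M[K]_(p, q)) a u v :
  bform (a *: X) u v = a * bform X u v.
Proof. by rewrite /bform -scalemxAr -scalemxAl mxE. Qed.

Lemma bform_tr p q (X : 'M[K]_(p, q)) u v : bform X u v = bform X^T v u.
Proof.
rewrite /bform; have -> : v^T *m X^T *m u = (u^T *m X *m v)^T.
  by rewrite !trmx_mul trmxK mulmxA.
by rewrite [RHS]mxE.
Qed.

Lemma bform_mull p q r (X : 'M[K]_(p, q)) (A : 'M[K]_(p, r)) u v :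
  bform X (A *m u) v = bform (A^T *m X) u v.
Proof. by rewrite /bform trmx_mul !mulmxA. Qed.

Lemma bform_mulr p q r (X : 'M[K]_(p, q)) (A : 'M[K]_(q, r)) u v :
  bform X u (A *m v) = bform (X *m A) u v.
Proof. by rewrite /bform !mulmxA. Qed.

Lemma bform_sandwich p q r s (X : 'M[K]_(p, q)) (A : 'M[K]_(p, r))
  (B : 'M[K]_(q, s)) u v :
  bform (A^T *m X *m B) u v = bform X (A *m u) (B *m v).
Proof. by rewrite bform_mull bform_mulr. Qed.

Lemma bform0l p q (X : 'M[K]_(p, q)) v : bform X 0 v = 0.
Proof. by rewrite /bform trmx0 !mul0mx mxE. Qed.

Lemma bform_delta p q (X : 'M[K]_(p, q)) i j :
  bform X (delta_mx i 0) (delta_mx j 0) = X i j.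
Proof. by rewrite /bform trmx_delta -rowE -colE !mxE. Qed.

Lemma bform_sum p q (X : 'M[K]_(p, q)) u v :
  bform X u v = \sum_j \sum_i u i 0 * X i j * v j 0.
Proof.
rewrite /bform mxE; apply: eq_bigr => j _; rewrite mxE mulr_suml.
by apply: eq_bigr => i _; rewrite mxE.
Qed.

Lemma bform1 p (u : 'cV[K]_p) : bform 1%:M u u = \sum_i u i 0 ^+ 2.
Proof.
by rewrite /bform mulmx1 mxE; apply: eq_bigr => i _; rewrite mxE expr2.
Qed.

End BilinearForms.

(** * The Loewner order and the Thompson metric *)

Section LoewnerOrder.
Context {K : realType}.
Implicit Types n : nat.

Lemma pd_psd n (X : 'M[K]_n) : pd_set X -> psd_set X.
Proof.
move=> [sX pX]; split=> // x; have [->|x0] := eqVneq x 0.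
  by rewrite mulmx0 mxE.
exact/ltW/pX.
Qed.

Lemma pd_form_gt0 n (X : 'M[K]_n) x : pd_set X -> x != 0 -> 0 < bform X x x.
Proof. by move=> [_ pX] /pX. Qed.

Lemma psd_form_ge0 n (X : 'M[K]_n) x : psd_set X -> 0 <= bform X x x.
Proof. by move=> [_ pX]; apply: pX. Qed.

Lemma bform_sym n (X : 'M[K]_n) u v :
  X^T = X -> bform X u v = bform X v u.
Proof. by move=> sX; rewrite bform_tr sX. Qed.

Lemma loewnerP n (X Y : 'M[K]_n) : X^T = X -> Y^T = Y ->
  loewner_le X Y <-> forall x, bform X x x <= bform Y x x.
Proof.
move=> sX sY; split=> [[_ XY] x|XY].
  by have := XY x; rewrite -/(bform _ _ _) bformD bformN subr_ge0.
split=> [|x]; first by rewrite linearB /= sX sY.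
by rewrite -/(bform _ _ _) bformD bformN subr_ge0.
Qed.

Lemma loewner_le_form n (X Y : 'M[K]_n) x :
  loewner_le X Y -> bform X x x <= bform Y x x.
Proof.
by move=> [_ /(_ x)]; rewrite -/(bform _ _ _) bformD bformN subr_ge0.
Qed.

Lemma loewner_refl n (X : 'M[K]_n) : loewner_le X X.
Proof.
by rewrite /loewner_le subrr; split=> [|x]; rewrite ?trmx0 // mulmx0 mul0mx mxE.
Qed.

(** Nonnegativity of the form at [a u + b v] for all [a, b] gives the inequality
    after the usual choice of [a, b]; semidefiniteness forces a separate
    treatment of [u] with zero form. *)
Lemma cauchy_schwarz_psd n (X : 'M[K]_n) u v : psd_set X ->
  bform X u v ^+ 2 <= bform X u u * bform X v v.
Proof.
move=> psdX; have sX := psdX.1.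
have H a b : 0 <= a ^+ 2 * bform X u u + 2 * a * b * bform X u v
     + b ^+ 2 * bform X v v.
  have := psd_form_ge0 (a *: u + b *: v) psdX.
  rewrite !(bformDl, bformDr, bformZl, bformZr) (bform_sym v u sX).
  by move=> /le_trans; apply; rewrite le_eqVlt; apply/orP; left; apply/eqP;
    ring.
have u0 := psd_form_ge0 u psdX; have v0 := psd_form_ge0 v psdX.
move: H u0 v0; move: (bform X u u) (bform X v v) (bform X u v) => a b c H a0 b0.
have [a_gt0|] := ltP 0 a.
  have := H (- c) a.
  rewrite (_ : _ + _ = a * (a * b - c ^+ 2)); last by ring.
  by rewrite pmulr_rge0 // subr_ge0.
move=> a_le0; have a00 : a = 0 by lra.
rewrite a00 in H *; have := H (b + 1) (- c); rewrite mulr0 mul0r add0r.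
rewrite (_ : _ + _ = - (c ^+ 2 * (b + 2))); last by ring.
by rewrite oppr_ge0 pmulr_lle0 //; lra.
Qed.

Lemma form_le_norm n (X : 'M[K]_n) : exists2 c : K, 0 <= c &
  forall x, bform X x x <= c * bform 1%:M x x.
Proof.
exists (\sum_j \sum_i `|X i j|).
  by apply: sumr_ge0 => j _; apply: sumr_ge0 => i _.
move=> x; rewrite bform_sum mulr_suml; apply: ler_sum => j _.
rewrite mulr_suml; apply: ler_sum => i _.
have sq k : x k 0 ^+ 2 <= bform 1%:M x x.
  by rewrite bform1 (bigD1 k) //= lerDl sumr_ge0 // => l _; rewrite sqr_ge0.
have := sq i; have := sq j; move: (x i 0) (x j 0) (bform _ _ _) => a b s hb ha.
apply: (@le_trans _ _ (`|X i j| * (`|a| * `|b|))).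
  by rewrite -!normrM mulrCA mulrA ler_norm.
apply: ler_wpM2l => //.
have : (`|a| - `|b|) ^+ 2 >= 0 by rewrite sqr_ge0.
have := real_normK (num_real a); have := real_normK (num_real b).
nra.
Qed.

Lemma pd_unit n (X : 'M[K]_n) : pd_set X -> X \in unitmx.
Proof.
move=> pX; rewrite -row_free_unit -kermx_eq0; apply/eqP/row_matrixP => i.
rewrite row0; set u := row i _.
have uX : u *m X = 0 by apply/sub_kermxP; rewrite row_sub.
apply/eqP/negPn/negP => u0.
have u0' : u^T != 0 by rewrite trmx_eq0.
have := pd_form_gt0 pX u0'.
by rewrite /bform trmxK uX mul0mx mxE ltxx.
Qed.

Lemma pd_inv n (X : 'M[K]_n) : pd_set X -> pd_set (invmx X).
Proof.
move=> pX; have uX := pd_unit pX; split; first by rewrite trmx_inv pX.1.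
move=> x x0; have y0 : invmx X *m x != 0.
  by apply: contraNneq x0 => /(congr1 (mulmx X));
    rewrite mulKVmx // mulmx0 => ->.
have := pd_form_gt0 pX y0.
by rewrite bform_mulr bform_mull mulmxA trmx_inv pX.1 mulVmx // mul1mx.
Qed.

(** Cauchy-Schwarz for [invmx X] gives |x|^4 <= (x' X^-1 x) (x' X x), and the
    first factor is at most a multiple of |x|^2. *)
Lemma norm_le_pd n (X : 'M[K]_n) : pd_set X -> exists2 c : K, 0 <= c &
  forall x, bform 1%:M x x <= c * bform X x x.
Proof.
move=> pX; have [c c0 Hc] := form_le_norm (invmx X); exists c => // x.
(* The form of [invmx X] at [X *m x] is the form of [X] at [x]. *)
have := cauchy_schwarz_psd (X *m x) x (pd_psd (pd_inv pX)).
have -> : bform (invmx X) (X *m x) x = bform 1%:M x x.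
  by rewrite bform_mull pX.1 mulmxV // pd_unit.
have -> : bform (invmx X) (X *m x) (X *m x) = bform X x x.
  by rewrite bform_mull bform_mulr pX.1 mulmxV ?mul1mx // pd_unit.
have := Hc x; have := psd_form_ge0 x (pd_psd pX).
have n0 : 0 <= bform 1%:M x x.
  by rewrite bform1 sumr_ge0 // => i _; rewrite sqr_ge0.
move: n0; move: (bform 1%:M x x) (bform X x x) (bform _ _ _) => a b d.
rewrite le_eqVlt => /orP[/eqP <-|a0] b0 ad abd; first by rewrite mulr_ge0.
by rewrite -(ler_pM2r a0); nra.
Qed.

(** Makes the set defining [M_ratio X Y] nonempty. *)
Lemma loewner_dominated n (X Y : 'M[K]_n) : X^T = X -> pd_set Y ->
  exists t : K, loewner_le X (t *: Y).
Proof.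
move=> sX pY; have [c c0 Hc] := form_le_norm X; have [d d0 Hd] := norm_le_pd pY.
exists (c * d); apply/loewnerP => //; first by rewrite linearZ /= pY.1.
move=> x; rewrite bformZ -mulrA; apply: (le_trans (Hc x)).
by rewrite ler_wpM2l.
Qed.

Lemma exists_cV_neq0 n : (0 < n)%N -> exists x : 'cV[K]_n, x != 0.
Proof.
case: n => // n _; exists (delta_mx 0 0).
by apply/eqP => /matrixP/(_ 0 0)/eqP; rewrite !mxE !eqxx oner_eq0.
Qed.

(** The infimum defining [M_ratio] is attained, since every quotient
    x' X x / x' Y x is a lower bound of the set. *)
Lemma form_le_M_ratio n (X Y : 'M[K]_n) x : X^T = X -> pd_set Y ->
  bform X x x <= M_ratio X Y * bform Y x x.
Proof.
move=> sX pY; have [->|x0] := eqVneq x 0; first by rewrite !bform0l mulr0.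
have yx := pd_form_gt0 pY x0.
rewrite -ler_pdivrMr //; apply: lb_le_inf; first exact: loewner_dominated.
move=> t /loewner_le_form -/(_ x); rewrite bformZ.
by rewrite ler_pdivrMr.
Qed.

Lemma M_ratio_le n (X Y : 'M[K]_n) t : (0 < n)%N -> pd_set Y ->
  loewner_le X (t *: Y) -> M_ratio X Y <= t.
Proof.
move=> n0 pY XtY; apply: ge_inf => //.
have [x x0] := exists_cV_neq0 n0; have yx := pd_form_gt0 pY x0.
exists (bform X x x / bform Y x x) => s /loewner_le_form -/(_ x).
by rewrite bformZ ler_pdivrMr.
Qed.

Lemma M_ratio_attained n (X Y : 'M[K]_n) : X^T = X -> pd_set Y ->
  loewner_le X (M_ratio X Y *: Y).
Proof.
move=> sX pY; apply/loewnerP => //; first by rewrite linearZ /= pY.1.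
by move=> x; rewrite bformZ form_le_M_ratio.
Qed.

Lemma sym_eq_of_forms n (X Y : 'M[K]_n) : X^T = X -> Y^T = Y ->
  (forall x, bform X x x = bform Y x x) -> X = Y.
Proof.
move=> sX sY XY; apply/matrixP => i j.
have := XY (delta_mx i 0 + delta_mx j 0).
rewrite !(bformDl, bformDr) !XY (bform_sym (delta_mx j 0) _ sX).
rewrite (bform_sym (delta_mx j 0) _ sY) !bform_delta; lra.
Qed.

Lemma M_ratio_gt0 n (X Y : 'M[K]_n) : (0 < n)%N ->
  pd_set X -> pd_set Y -> 0 < M_ratio X Y.
Proof.
move=> n0 pX pY; have [x x0] := exists_cV_neq0 n0.
have := form_le_M_ratio x pX.1 pY; have := pd_form_gt0 pX x0.
have := pd_form_gt0 pY x0; nra.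
Qed.

Lemma loewner_le_scale n (X Y : 'M[K]_n) s t : pd_set Y ->
  loewner_le X (s *: Y) -> s <= t -> X^T = X -> loewner_le X (t *: Y).
Proof.
move=> pY XsY st sX; apply/loewnerP => //; first by rewrite linearZ /= pY.1.
move=> x; apply: (le_trans (loewner_le_form x XsY)).
by rewrite !bformZ ler_wpM2r // psd_form_ge0 //; exact: pd_psd.
Qed.

(** The denominators in [Lip] are logarithms of this maximum: they are positive,
    so that a bound on a quotient is a bound on its numerator. *)
Lemma max_M_ratio_gt1 n (X Y : 'M[K]_n) : (0 < n)%N ->
  pd_set X -> pd_set Y -> X <> Y -> 1 < Num.max (M_ratio X Y) (M_ratio Y X).
Proof.
move=> n0 pX pY XY; rewrite ltNge; apply/negP; rewrite ge_max => /andP[h1 h2].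
apply: XY; apply: sym_eq_of_forms pX.1 pY.1 _ => x.
have a := form_le_M_ratio x pX.1 pY; have b := form_le_M_ratio x pY.1 pX.
have c := psd_form_ge0 x (pd_psd pX); have d := psd_form_ge0 x (pd_psd pY).
by apply/eqP; rewrite eq_le; apply/andP; split; nra.
Qed.

(** With t the larger of the two ratios of P1 and P2, the hypothesis applies in
    both directions, and ln (t ^ k) = k ln t. *)
Lemma Lip_le n (F : 'M[K]_n -> 'M[K]_n) (k : K) : (0 < n)%N ->
  (forall P, pd_set P -> pd_set (F P)) ->
  (forall P1 P2 t, pd_set P1 -> pd_set P2 -> 1 <= t ->
     loewner_le P1 (t *: P2) -> loewner_le (F P1) (t `^ k *: F P2)) ->
  (Lip F (@pd_set K n) <= k%:E)%E.
Proof.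
move=> n0 Fpd FH; apply: ge_ereal_sup => _ [P1 [P2 [p1 p2 P12 ->]]].
have t1 := max_M_ratio_gt1 n0 p1 p2 P12; rewrite lee_fin /thompson.
move: t1; set t := Num.max _ _ => t1.
rewrite ler_pdivrMr ?ln_gt0 // -ln_powR.
rewrite ler_ln ?posrE ?powR_gt0 ?(lt_trans _ t1) //.
  have t1' := ltW t1.
  rewrite ge_max !M_ratio_le //; try exact: Fpd.
    apply: FH => //; apply: loewner_le_scale (M_ratio_attained _ _) _ _ => //;
    by [exact: p2.1 | rewrite /t le_max lexx orbT].
  apply: FH => //; apply: loewner_le_scale (M_ratio_attained _ _) _ _ => //;
    by [exact: p1.1 | rewrite /t le_max lexx].
by rewrite lt_max M_ratio_gt0 //; exact: Fpd.
Qed.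

End LoewnerOrder.

(** * The one-dimensional contraction estimate *)

Section Scalar.
Context {K : realType}.
Implicit Types (mu z t : K).

(** The supremum over x > 0 of the logarithmic derivative in ln x of
    (1 + (1 + mu) x) / (1 + x). *)
Definition rate mu := mu / (1 + Num.sqrt (1 + mu)) ^+ 2.

(** The substitution [mu = s ^+ 2 - 1] makes the rate rational. *)
Lemma rateE mu : 0 <= mu -> exists2 s, 1 <= s &
  mu = s ^+ 2 - 1 /\ rate mu = (s - 1) / (s + 1).
Proof.
move=> mu0; exists (Num.sqrt (1 + mu)).
  by rewrite -[leLHS]sqrtr1 ler_sqrt ?lerDl ?ler_wpDr.
rewrite sqr_sqrtr; last by lra.
split; first by lra.
have := sqr_sqrtr (_ : 0 <= 1 + mu); rewrite /rate.
have := sqrtr_ge0 (1 + mu); move: (Num.sqrt _) => s s0 /(_ _) E.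
have -> : mu = s ^+ 2 - 1 by rewrite E; lra.
by field; apply: lt0r_neq0; lra.
Qed.

Lemma rate_lt1 mu : 0 <= mu -> rate mu < 1.
Proof.
by move=> /rateE[s s1 [_ ->]]; rewrite ltr_pdivrMr; lra.
Qed.

Lemma rate_ge0 mu : 0 <= mu -> 0 <= rate mu.
Proof.
by move=> /rateE[s s1 [_ ->]]; rewrite divr_ge0; lra.
Qed.

Lemma is_derive_ln_affine (a b t : K) : 0 < a + t * b ->
  is_derive t 1 (fun t => ln (a + t * b)) (b / (a + t * b)).
Proof.
move=> H.
have h : is_derive t 1 (fun t : K => a + t * b) b.
  apply: is_derive_eq; rewrite /GRing.scale /=; ring.
have := is_derive1_ln H => hl.
have := @is_derive1_comp _ (@ln K) (fun t => a + t * b) t _ _ hl h.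
by rewrite mulrC.
Qed.

(** Taking logarithms, the difference of the two sides is a function of t that
    vanishes at t = 1; its derivative is a nonnegative multiple of the square of
    (1 - z) - s t z, where s = sqrt (1 + mu), so it is monotone. *)
Lemma moebius_contraction mu z t : 0 <= mu -> 0 <= z <= 1 -> 1 <= t ->
  1 + mu * (t * z / (1 + (t - 1) * z)) <= t `^ rate mu * (1 + mu * z).
Proof.
move=> mu0 /andP[z0 z1] t1.
have p1 x : 1 <= x -> 0 < (1 - z) + x * (z * (1 + mu)).
  move=> x1; rewrite (_ : _ + _ = 1 + ((x - 1) * z + x * z * mu)); last by ring.
  by rewrite ltr_pwDl // addr_ge0 // !mulr_ge0 //; lra.
have p2 x : 1 <= x -> 0 < (1 - z) + x * z.
  move=> x1; rewrite (_ : _ + _ = 1 + (x - 1) * z); last by ring.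
  by rewrite ltr_pwDl // mulr_ge0 //; lra.
pose L (x : K) : K := rate mu * ln x - ln ((1 - z) + x * (z * (1 + mu)))
  + ln ((1 - z) + x * z).
have dL (x : K) : 1 <= x -> is_derive x 1 L
   (rate mu * x^-1 - z * (1 + mu) / ((1 - z) + x * (z * (1 + mu)))
    + z / ((1 - z) + x * z)).
  move=> x1; have x0 : 0 < x by lra.
  have := is_derive1_ln x0; have := is_derive_ln_affine (p1 _ x1).
  have := is_derive_ln_affine (p2 _ x1) => h2 h1 h3.
  exact: (is_deriveD (is_deriveB (is_deriveZ (rate mu) h3) h1) h2).
have L1t : L 1 <= L t.
  apply: (fun d g c => @ger0_derive1_ndecry K L 1 d g c 1 t (lexx 1) t1).
  - by move=> x; rewrite in_itv /= andbT => /ltW /dL [].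
  - move=> x; rewrite in_itv /= andbT => /ltW x1.
    rewrite derive1E; have [_ ->] := dL _ x1.
    have x0 : 0 < x by lra.
    have [s s1 [Emu ->]] := rateE mu0.
    rewrite /= /GRing.scale /=.
    have q1 := p1 _ x1; have q2 := p2 _ x1.
    suff -> : (s - 1) / (s + 1) * x^-1
        - z * (1 + mu) / (1 - z + x * (z * (1 + mu))) + z / (1 - z + x * z) =
       (s - 1) * ((1 - z) - s * x * z) ^+ 2 /
       ((s + 1) * x * (1 - z + x * (z * (1 + mu))) * (1 - z + x * z)).
      apply: divr_ge0; first by rewrite mulr_ge0 ?sqr_ge0; lra.
      by rewrite !mulr_ge0 //; lra.
    subst mu; field.
    do ![apply/andP; split]; apply: lt0r_neq0; lra.
  - apply: derivable_within_continuous => x;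
    rewrite in_itv /= andbT => /dL [] //.
have t0 : 0 < t by lra.
have q0 : 0 < 1 + mu * z by nra.
have q1 := p1 _ t1; have q2 := p2 _ t1.
have -> : 1 + (t - 1) * z = 1 - z + t * z by ring.
have -> : 1 + mu * (t * z / (1 - z + t * z)) =
  (1 - z + t * (z * (1 + mu))) / (1 - z + t * z) by field; apply: lt0r_neq0.
rewrite -ler_ln ?posrE ?divr_gt0 ?mulr_gt0 ?powR_gt0 //.
rewrite lnM ?posrE ?powR_gt0 // ln_powR ln_div ?posrE //.
move: L1t; rewrite /L ln1 mulr0 !mul1r.
have -> : 1 - z + z * (1 + mu) = 1 + mu * z by ring.
by rewrite subrK ln1; lra.
Qed.

(** The factor of growth (q + rho A) / (q + rho z), with A >= z, increases with
    rho, so the worst case rho = mu q is the Moebius estimate. *)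
Lemma scalar_contraction mu q rho z t :
  0 <= mu -> 0 <= q -> 0 <= z <= 1 -> 1 <= t -> 0 <= rho <= mu * q ->
  q + rho * (t * z / (1 + (t - 1) * z)) <= t `^ rate mu * (q + rho * z).
Proof.
move=> mu0 q0 z01 t1 /andP[r0 rq].
have H := moebius_contraction mu0 z01 t1.
have T1 : 1 <= t `^ rate mu by rewrite -(powRr0 t) ler_powR // rate_ge0.
move: z01 => /andP[z0 z1].
have Dp : 0 < 1 + (t - 1) * z by nra.
have Az : z <= t * z / (1 + (t - 1) * z).
  have h : 0 <= (t - 1) * (z * (1 - z)) by rewrite !mulr_ge0 //; lra.
  by rewrite ler_pdivlMr //; nra.
move: H T1 Az; move: (t `^ _) (t * z / _) => T A H T1 Az.
have [m0|] := ltP 0 mu; last first.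
  move=> m0; have mu00 : mu = 0 by lra.
  rewrite mu00 in rq.
  have r00 : rho = 0 by lra.
  rewrite r00 !mul0r !addr0 ler_peMl //.
have h : (mu * q - rho) * (T - 1) >= 0 by apply: mulr_ge0; lra.
have h2 := ler_wpM2l r0 H.
rewrite -(ler_pM2l m0); nra.
Qed.

End Scalar.

(** * Scaling one term of a parallel sum *)

Section ParallelSum.
Context {K : realType} {r : nat}.
Variables (N Rb : 'M[K]_r) (y v0 : 'cV[K]_r).
Hypotheses (Npsd : psd_set N) (Rpsd : psd_set Rb).
Let Phi t v := t * bform N (y - v) (y - v) + bform Rb v v.
Hypothesis v0min : forall v, Phi 1 v0 <= Phi 1 v.

Lemma cost_on_segment t l : Phi t ((1 - l) *: y + l *: v0) =
  t * (l ^+ 2 * bform N (y - v0) (y - v0)) + (1 - l) ^+ 2 * bform Rb y y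
  + 2 * l * (1 - l) * bform Rb y v0 + l ^+ 2 * bform Rb v0 v0.
Proof.
rewrite /Phi (_ : y - _ = l *: (y - v0)); last first.
  by apply/matrixP => i j; rewrite !mxE; ring.
rewrite !(bformDl, bformDr, bformZl, bformZr, bformNl, bformNr).
by rewrite (bform_sym v0 y Rpsd.1); ring.
Qed.

(** The first-order optimality condition in the direction [y - v0]: along the
    line through [y] and [v0] the cost is a quadratic polynomial minimal at
    [l = 1], hence without linear term there. *)
Lemma minimum_eq_inner : Phi 1 v0 = bform Rb y v0.
Proof.
have H l : 0 <= Phi 1 ((1 - l) *: y + l *: v0) - Phi 1 v0.
  by rewrite subr_ge0.
have a0 := psd_form_ge0 (y - v0) Npsd.
have b0 := psd_form_ge0 v0 Rpsd.
have r0 := psd_form_ge0 y Rpsd.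
have psi (l : K) : 0 <= (l - 1) ^+ 2 * (bform N (y - v0) (y - v0)
  + bform Rb y y - 2 * bform Rb y v0 + bform Rb v0 v0)
  + 2 * (l - 1) * (Phi 1 v0 - bform Rb y v0).
  apply: (le_trans (H l)); rewrite cost_on_segment /Phi le_eqVlt.
  by apply/orP; left; apply/eqP; ring.
set d := Phi 1 v0 - bform Rb y v0 in psi.
set c := (bform N _ _ + _ - _ + _) in psi.
have c0 : 0 <= c by have := psi 2; have := psi 0; lra.
have c1 : 0 < c + 1 by lra.
(* Minimality says 0 <= c h^2 + 2 d h for all h; h = - d / (c + 1) forces
   d = 0 even when c = 0. *)
have := psi (1 - d / (c + 1)).
rewrite (_ : _ + _ = - (d ^+ 2 * ((c + 2) / (c + 1) ^+ 2))); last first.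
  by field; exact: lt0r_neq0.
rewrite oppr_ge0 pmulr_lle0; last by rewrite divr_gt0 ?exprn_gt0 //; lra.
move=> d2; apply/eqP; rewrite -subr_eq0 -/d -sqrf_eq0 eq_le d2.
exact: sqr_ge0.
Qed.

(** In dimension one, with N = w and Rb = 1, the minimum is w / (1 + w) times
    y^2, and the claim is the effect of w -> t w on z = w / (1 + w).  In general
    the trial point is [(1 - l) y + l v0] with the one-dimensional optimal
    [l], and Cauchy-Schwarz for Rb, which gives rho z^2 <= v0' Rb v0, says that
    the one-dimensional case is the worst one. *)
Lemma parallel_sum_scaling : exists2 z, 0 <= z <= 1 &
  Phi 1 v0 = bform Rb y y * z /\
  forall t, 1 <= t ->
    exists v, Phi t v <= bform Rb y y * (t * z / (1 + (t - 1) * z)).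
Proof.
have E := minimum_eq_inner; have cs := cauchy_schwarz_psd y v0 Rpsd.
have a0 := psd_form_ge0 (y - v0) Npsd.
have b0 := psd_form_ge0 v0 Rpsd.
have r0 := psd_form_ge0 y Rpsd.
have seg := cost_on_segment.
have Phiy t : Phi t y = bform Rb y y.
  by rewrite /Phi subrr bform0l mulr0 add0r.
have Ev : Phi 1 v0 = bform N (y - v0) (y - v0) + bform Rb v0 v0.
  by rewrite /Phi mul1r.
move: E cs a0 b0 r0 seg (v0min y) Ev; rewrite Phiy; move: Phiy.
move: (bform N _ _) (bform Rb v0 v0) (bform Rb y v0) (bform Rb y y).
move=> al be a rho Phiy -> cs al0 be0 rho0 seg ar Ev.
move: rho0; rewrite le_eqVlt => /orP[/eqP rho0|rho0].
  exists 0; first by rewrite lexx ler01.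
  split; first by rewrite -rho0 mulr0; lra.
  by move=> t t1; exists y; rewrite Phiy -rho0 mul0r.
have z0 : 0 <= a / rho by rewrite divr_ge0 //; lra.
have z1 : a / rho <= 1 by rewrite ler_pdivrMr ?mul1r.
exists (a / rho); first by rewrite z0 z1.
have aE : a = rho * (a / rho) by field; exact: lt0r_neq0.
split=> // t t1.
set z := a / rho in z0 z1 aE *.
have D0 : 0 < 1 + (t - 1) * z by rewrite ltr_pwDl // mulr_ge0 //; lra.
(* [l = 1 / (1 + (t - 1) z)] minimizes the value on the segment when
   v0' Rb v0 equals rho z^2. *)
exists ((1 - (1 + (t - 1) * z)^-1) *: y + (1 + (t - 1) * z)^-1 *: v0).
rewrite seg.
have bez : rho * z ^+ 2 <= be.
  rewrite -(ler_pM2l rho0) (_ : rho * (rho * z ^+ 2) = (rho * z) ^+ 2);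
    last by ring.
  by rewrite -aE.
have -> : al = a - be by lra.
set l := (1 + (t - 1) * z)^-1.
have l0 : 0 <= l by rewrite invr_ge0 ltW.
have -> : rho * (t * z * l) = t * (l ^+ 2 * (rho * z - rho * z ^+ 2))
  + (1 - l) ^+ 2 * rho + 2 * l * (1 - l) * (rho * z) + l ^+ 2 * (rho * z ^+ 2).
  by rewrite /l; field; exact: lt0r_neq0.
rewrite -aE -subr_ge0.
rewrite (_ : _ - _ = (t - 1) * l ^+ 2 * (be - rho * z ^+ 2)); last by ring.
by rewrite !mulr_ge0 ?sqr_ge0 //; lra.
Qed.

End ParallelSum.

(** * Riccati operators as minimal costs *)

Section Riccati.
Context {K : realType} {n m : nat}.
Variables (A C : 'M[K]_n) (B D : 'M[K]_(n, m)) (Q : 'M[K]_n) (R : 'M[K]_m).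
Hypotheses (Qpd : pd_set Q) (Rpd : pd_set R).
Let F := riccati A C B D Q R.

(** The cost whose minimum over [u] is the form of the Riccati operator. *)
Definition stage_cost (P : 'M[K]_n) (x : 'cV[K]_n) (u : 'cV[K]_m) : K :=
  bform P (A *m x + B *m u) (A *m x + B *m u)
  + bform P (C *m x + D *m u) (C *m x + D *m u)
  + bform Q x x + bform R u u.

Definition ctrl_weight (P : 'M[K]_n) := R + B^T *m P *m B + D^T *m P *m D.

Lemma ctrl_weight_pd P : psd_set P -> pd_set (ctrl_weight P).
Proof.
move=> pP; split.
  by rewrite /ctrl_weight !linearD /= !trmx_mul !trmxK pP.1 Rpd.1 !mulmxA.
move=> u u0; rewrite -/(bform _ _ _) /ctrl_weight !bformD !bform_sandwich.
rewrite -addrA ltr_pwDl ?addr_ge0 //; first exact: pd_form_gt0.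
  exact: psd_form_ge0.
exact: psd_form_ge0.
Qed.

Lemma riccati_sym P : psd_set P -> (F P)^T = F P.
Proof.
move=> pP; rewrite /F /riccati -/(ctrl_weight P).
move: (B^T *m P *m A + _) => G.
rewrite !(linearB, linearD) /= !trmx_mul !trmxK trmx_inv.
by rewrite (ctrl_weight_pd pP).1 pP.1 Qpd.1 !mulmxA.
Qed.

(** Completing the square in [u]. *)
Lemma stage_cost_square P x u : psd_set P ->
  let G := B^T *m P *m A + D^T *m P *m C in
  let w := u + invmx (ctrl_weight P) *m G *m x in
  stage_cost P x u = bform (F P) x x + bform (ctrl_weight P) w w.
Proof.
move=> pP G; have uM := pd_unit (ctrl_weight_pd pP).
have sM := (ctrl_weight_pd pP).1.
have -> : bform (F P) x x = bform P (A *m x) (A *m x)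
   + bform P (C *m x) (C *m x) + bform Q x x
   - bform (invmx (ctrl_weight P)) (G *m x) (G *m x).
  rewrite /F /riccati -/(ctrl_weight P) -/G !(bformD, bformN).
  by rewrite !bform_sandwich.
move=> w; rewrite /w -mulmxA !(bformDl, bformDr).
set g := G *m x.
have -> : bform (ctrl_weight P) (invmx (ctrl_weight P) *m g)
     (invmx (ctrl_weight P) *m g) = bform (invmx (ctrl_weight P)) g g.
  by rewrite bform_mull bform_mulr trmx_inv sM mulVmx // mul1mx.
have -> : bform (ctrl_weight P) (invmx (ctrl_weight P) *m g) u = bform 1%:M u g.
  by rewrite bform_mull trmx_inv sM mulVmx // bform_tr trmx1.
have -> : bform (ctrl_weight P) u (invmx (ctrl_weight P) *m g) = bform 1%:M u g.
  by rewrite bform_mulr mulmxV.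
have -> : bform 1%:M u g =
    bform P (B *m u) (A *m x) + bform P (D *m u) (C *m x).
  by rewrite /g bform_mulr mul1mx /G bformD !bform_sandwich.
have -> : bform (ctrl_weight P) u u = bform R u u + bform P (B *m u) (B *m u)
   + bform P (D *m u) (D *m u).
  by rewrite /ctrl_weight !bformD !bform_sandwich.
rewrite /stage_cost !(bformDl, bformDr).
rewrite (bform_sym (A *m x) (B *m u) pP.1) (bform_sym (C *m x) (D *m u) pP.1).
ring.
Qed.

Lemma riccati_le_cost P x u : psd_set P ->
  bform (F P) x x <= stage_cost P x u.
Proof.
move=> pP; rewrite stage_cost_square // lerDl.
by apply/psd_form_ge0/pd_psd/ctrl_weight_pd.
Qed.

Lemma riccati_cost_attained P x : psd_set P ->
  exists u, bform (F P) x x = stage_cost P x u.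
Proof.
move=> pP.
exists (- (invmx (ctrl_weight P) *m (B^T *m P *m A + D^T *m P *m C) *m x)).
by rewrite stage_cost_square // addNr bform0l addr0.
Qed.

(** The minimal cost is at least x' Q x. *)
Lemma riccati_pd P : psd_set P -> pd_set (F P).
Proof.
move=> pP; split=> [|x x0]; first exact: riccati_sym.
have [u E] := riccati_cost_attained x pP; rewrite -/(bform _ _ _) E /stage_cost.
have := pd_form_gt0 Qpd x0; have := psd_form_ge0 u (pd_psd Rpd).
have := psd_form_ge0 (A *m x + B *m u) pP.
have := psd_form_ge0 (C *m x + D *m u) pP; lra.
Qed.

Lemma riccati_nonexpansive P1 P2 t : psd_set P1 -> psd_set P2 -> 1 <= t ->
  loewner_le P1 (t *: P2) -> loewner_le (F P1) (t *: F P2).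
Proof.
move=> p1 p2 t1 P12; apply/loewnerP; first exact: riccati_sym.
  by rewrite linearZ /= riccati_sym.
move=> x; have [u E] := riccati_cost_attained x p2; rewrite bformZ E.
apply: (le_trans (riccati_le_cost x u p1)); rewrite /stage_cost.
have := loewner_le_form (A *m x + B *m u) P12.
have := loewner_le_form (C *m x + D *m u) P12; rewrite !bformZ.
have := psd_form_ge0 u (pd_psd Rpd); have := psd_form_ge0 x (pd_psd Qpd).
nra.
Qed.

Lemma Lip_riccati_le1 : (0 < n)%N -> (Lip F (@pd_set K n) <= 1)%E.
Proof.
move=> n0; apply: Lip_le => // [P /pd_psd|P1 P2 t /pd_psd p1 /pd_psd p2 t1].
  exact: riccati_pd.
by rewrite powRr1; [exact: riccati_nonexpansive | lra].
Qed.

End Riccati.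

(** * Strict contraction under the range condition *)

Section Sufficiency.
Context {K : realType} {n m r : nat}.
Variables (Bb Db : 'M[K]_(n, r)) (S : 'M[K]_(r, n)) (W : 'M[K]_(r, m)).
Variables (Q : 'M[K]_n) (R : 'M[K]_m).
Hypotheses (Qpd : pd_set Q) (Rpd : pd_set R) (Wfree : row_free W).
Let Rb := invmx (W *m invmx R *m W^T).
Let F := riccati (Bb *m S) (Db *m S) (Bb *m W) (Db *m W) Q R.
Let N (P : 'M[K]_n) := Bb^T *m P *m Bb + Db^T *m P *m Db.

Lemma quotient_weight_inv_pd : pd_set (W *m invmx R *m W^T).
Proof.
have pI := pd_inv Rpd; split; first by rewrite !trmx_mul trmxK pI.1 !mulmxA.
move=> v v0; rewrite -/(bform _ _ _) -{1}[W]trmxK bform_sandwich.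
apply: pd_form_gt0 => //; apply: contraNneq v0 => Wv.
have [V WV] := row_freeP Wfree.
by rewrite -[v]mul1mx -trmx1 -WV trmx_mul -mulmxA Wv mulmx0.
Qed.

Lemma quotient_weight_pd : pd_set Rb.
Proof. exact/pd_inv/quotient_weight_inv_pd. Qed.

(** The minimizer of u' R u on the fibre W u = v; the second property is its
    optimality condition, R u being in the range of W'. *)
Lemma quotient_weight_lift v : exists2 u, W *m u = v &
  forall u', bform R u' u = bform Rb (W *m u') v.
Proof.
have uT := pd_unit quotient_weight_inv_pd; have uR := pd_unit Rpd.
exists (invmx R *m (W^T *m (Rb *m v))).
  by rewrite !mulmxA mulmxV // mul1mx.
move=> u'; rewrite bform_mulr mulmxV // bform_mulr mul1mx.
by rewrite bform_mulr bform_mull.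
Qed.

Lemma quotient_weight_le u : bform Rb (W *m u) (W *m u) <= bform R u u.
Proof.
have [u1 Wu1 E] := quotient_weight_lift (W *m u).
have := psd_form_ge0 (u - u1) (pd_psd Rpd).
rewrite !(bformDl, bformDr, bformNl, bformNr) (bform_sym u1 u Rpd.1) !E Wu1;
  lra.
Qed.

(** The cost as a function of [v = - W u], after u' R u has been minimized over
    the fibres of [W]. *)
Definition reduced_cost P x v : K :=
  bform (N P) (S *m x - v) (S *m x - v) + bform Rb v v + bform Q x x.

Lemma reduced_costE P x u :
  stage_cost (Bb *m S) (Db *m S) (Bb *m W) (Db *m W) Q R P x u =
  reduced_cost P x (- (W *m u))
  + (bform R u u - bform Rb (W *m u) (W *m u)).
Proof.
rewrite /reduced_cost bformNl bformNr !opprK bformD !bform_sandwich.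
by rewrite /stage_cost !mulmxDr !mulmxA; ring.
Qed.

Lemma riccati_le_reduced P x v : psd_set P ->
  bform (F P) x x <= reduced_cost P x v.
Proof.
move=> pP; have [u Wu E] := quotient_weight_lift (- v).
apply: (le_trans (riccati_le_cost _ _ _ _ _ Rpd x u pP)).
by rewrite reduced_costE E Wu opprK subrr addr0.
Qed.

Lemma riccati_reduced_attained P x : psd_set P ->
  exists v, bform (F P) x x = reduced_cost P x v.
Proof.
move=> pP; have [u E] := riccati_cost_attained
  (Bb *m S) (Db *m S) (Bb *m W) (Db *m W) Q Rpd x pP.
exists (- (W *m u)); apply/eqP; rewrite eq_le riccati_le_reduced // E.
by rewrite reduced_costE lerDl subr_ge0 quotient_weight_le.
Qed.

Lemma reduced_form_psd P : psd_set P -> psd_set (N P).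
Proof.
move=> pP; split; first by rewrite linearD /= !trmx_mul !trmxK pP.1 !mulmxA.
move=> z; rewrite -/(bform _ _ _) bformD !bform_sandwich.
by rewrite addr_ge0 // psd_form_ge0.
Qed.

Lemma riccati_contraction mu P1 P2 t : 0 <= mu ->
  loewner_le (S^T *m Rb *m S) (mu *: Q) ->
  psd_set P1 -> psd_set P2 -> 1 <= t ->
  loewner_le P1 (t *: P2) -> loewner_le (F P1) (t `^ rate mu *: F P2).
Proof.
move=> mu0 SQ p1 p2 t1 P12; apply/loewnerP; first exact: riccati_sym.
  by rewrite linearZ /= riccati_sym.
move=> x; have [v0 E] := riccati_reduced_attained x p2; rewrite bformZ.
have Rbpsd := pd_psd quotient_weight_pd.
have vmin v : 1 * bform (N P2) (S *m x - v0) (S *m x - v0) + bform Rb v0 v0 <=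
    1 * bform (N P2) (S *m x - v) (S *m x - v) + bform Rb v v.
  have := riccati_le_reduced x v p2.
  by rewrite -/F E /reduced_cost lerD2r !mul1r.
have [z z01 [E0 H]] := parallel_sum_scaling (reduced_form_psd p2) Rbpsd vmin.
have [v Hv] := H t t1.
have rhomu : 0 <= bform Rb (S *m x) (S *m x) <= mu * bform Q x x.
  rewrite psd_form_ge0 //=.
  by have := loewner_le_form x SQ; rewrite bform_sandwich bformZ.
have -> : bform (F P2) x x = bform Q x x + bform Rb (S *m x) (S *m x) * z.
  by rewrite E /reduced_cost -E0 mul1r addrC.
have q0 := psd_form_ge0 x (pd_psd Qpd).
apply: le_trans (scalar_contraction mu0 q0 z01 t1 rhomu).
apply: (le_trans (riccati_le_reduced x v p1)).
rewrite /reduced_cost addrC lerD2l; apply: le_trans Hv; rewrite lerD2r.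
rewrite !bformD !bform_sandwich mulrDr lerD //.
  by have := loewner_le_form (Bb *m (S *m x - v)) P12; rewrite bformZ.
by have := loewner_le_form (Db *m (S *m x - v)) P12; rewrite bformZ.
Qed.

Lemma Lip_riccati_le_rate : (0 < n)%N ->
  let mu := M_ratio (S^T *m Rb *m S) Q in
  0 <= mu /\ (Lip F (@pd_set K n) <= (rate mu)%:E)%E.
Proof.
move=> n0 mu.
have sX : (S^T *m Rb *m S)^T = S^T *m Rb *m S.
  by rewrite !trmx_mul trmxK quotient_weight_pd.1 mulmxA.
have mu0 : 0 <= mu.
  have [x x0] := @exists_cV_neq0 K n n0; have := form_le_M_ratio x sX Qpd.
  rewrite bform_sandwich -(pmulr_lge0 _ (pd_form_gt0 Qpd x0)).
  exact/le_trans/psd_form_ge0/pd_psd/quotient_weight_pd.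
split=> //; apply: Lip_le => // [P /pd_psd|P1 P2 t /pd_psd p1 /pd_psd p2 t1].
  exact: riccati_pd.
by apply: riccati_contraction => //; exact: M_ratio_attained.
Qed.

End Sufficiency.

(** * Linear growth forces the Lipschitz constant 1 *)

Section GrowthBound.
Context {K : realType} {n : nat}.

Lemma scalar_pd (t : K) : 0 < t -> pd_set (t%:M : 'M[K]_n).
Proof.
move=> t0; split=> [|x x0]; first by rewrite tr_scalar_mx.
rewrite -/(bform _ _ _) -[t%:M]scalemx1 bformZ pmulr_rgt0 // bform1.
rewrite lt_neqAle sumr_ge0 ?andbT => [|i _]; last exact: sqr_ge0.
rewrite eq_sym; apply: contra x0 => /eqP/psumr_eq0P H; apply/eqP/matrixP => i j.
rewrite (ord1 j) [RHS]mxE; apply/eqP; rewrite -sqrf_eq0; apply/eqP/H => // k _.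
exact: sqr_ge0.
Qed.

Lemma thompson_scalar (t : K) : (0 < n)%N -> 1 <= t ->
  thompson (t%:M : 'M[K]_n) 1%:M = ln t.
Proof.
move=> n0 t1; have t0 : 0 < t := lt_le_trans ltr01 t1.
have I_pd := scalar_pd (ltr01 : 0 < 1 :> K).
have M1 : M_ratio (t%:M : 'M[K]_n) 1%:M = t.
  apply/eqP; rewrite eq_le M_ratio_le ?scalemx1 //=; last exact: loewner_refl.
  have [x x0] := @exists_cV_neq0 K n n0.
  have := form_le_M_ratio x (scalar_pd t0).1 I_pd.
  by rewrite -[t%:M]scalemx1 bformZ ler_pM2r // pd_form_gt0.
have M2 : M_ratio (1%:M : 'M[K]_n) t%:M <= t^-1.
  apply: M_ratio_le => //; first exact: scalar_pd.
  rewrite -[t%:M]scalemx1 scalerA mulVf ?gt_eqF // scale1r; exact: loewner_refl.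
rewrite /thompson M1 max_l // (le_trans M2) // (le_trans _ t1) //.
by rewrite invf_le1.
Qed.

(** Comparing F(t I) with F(I) through the single vector [x] gives
    a Thompson distance of at least ln t + ln (d / x' F(I) x), while t I and I
    are at distance ln t. *)
Lemma growth_Lip_ge1 (F : 'M[K]_n -> 'M[K]_n) (x : 'cV[K]_n) (d : K) :
  (forall P, pd_set P -> pd_set (F P)) -> x != 0 -> 0 < d ->
  (forall t, 0 < t -> t * d <= bform (F t%:M) x x) ->
  ~ (Lip F (@pd_set K n) < 1)%E.
Proof.
move=> Fpd x0 d0 H Lip1.
have n0 : (0 < n)%N.
  by move: x x0 {H}; case: (n) => // y /eqP[]; apply/matrixP => -[].
have I_pd := scalar_pd (ltr01 : 0 < 1 :> K).
have F1 := Fpd _ I_pd.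
have c0 := pd_form_gt0 F1 x0; set c := bform _ x x in c0.
pose b := ln (d / c).
have dc0 : 0 < d / c by rewrite divr_gt0.
have ratio s : 0 < s -> ((1 + b / s)%:E <= Lip F (@pd_set K n))%E.
  move=> s0; have t1 : 1 < expR s by rewrite expR_gt1.
  have t0 : 0 < expR s := expR_gt0 s.
  have Fs := Fpd _ (scalar_pd t0).
  apply: le_trans (ereal_sup_ubound _); last first.
    exists (expR s)%:M, 1%:M.
    split; [exact: scalar_pd | exact: I_pd | | reflexivity].
    move=> /matrixP/(_ (Ordinal n0) (Ordinal n0))/eqP.
    by rewrite !mxE eqxx !mulr1n gt_eqF.
  rewrite lee_fin thompson_scalar ?(ltW t1) // expRK.
  rewrite ler_pdivlMr // mulrDl mul1r divfK ?gt_eqF //.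
  have ltM : expR s * (d / c) <= M_ratio (F (expR s)%:M) (F 1%:M).
    rewrite mulrA ler_pdivrMr //; apply: (le_trans (H _ t0)).
    exact: form_le_M_ratio Fs.1 F1.
  have e0 : 0 < expR s * (d / c) by rewrite mulr_gt0.
  have -> : s + b = ln (expR s * (d / c)) by rewrite lnM ?posrE // expRK.
  rewrite /thompson ler_ln ?posrE ?le_max ?ltM //.
  by rewrite lt_max (lt_le_trans e0 ltM).
move: Lip1 ratio; case: (Lip _ _) => [l| |] //=.
- rewrite lte_fin => l1 ratio.
  have l0 : 0 < 1 - l by rewrite subr_gt0.
  have b1 : 0 < `|b| + 1 by rewrite ltr_wpDl.
  (* This t = exp s has s large enough for |b| / s < 1 - l, against the bound
     1 + b / s <= l. *)
  have s0 : 0 < (`|b| + 1) / (1 - l) by rewrite divr_gt0.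
  have := ratio _ s0; rewrite lee_fin invf_div mulrA -lerBrDl ler_pdivrMr //.
  have : - `|b| <= b by rewrite lerNl -normrN ler_norm.
  move: (`|b|) b1 => a a1 ab; nra.
- by move=> _ /(_ 1 ltr01).
Qed.

End GrowthBound.

(** * Growth of the Riccati operator off the range *)

Section Necessity.
Context {K : realType} {n m : nat}.
Variables (A C : 'M[K]_n) (B D : 'M[K]_(n, m)) (Q : 'M[K]_n) (R : 'M[K]_m).
Hypotheses (Qpd : pd_set Q) (Rpd : pd_set R).
Let F := riccati A C B D Q R.

(** Failure of the range condition yields [z] orthogonal to the range of (B; D)
    but not to that of (A; C).  With x = (A' C') z, the component along [z]
    of (Ax + Bu; Cx + Du) is the same for every [u], and Cauchy-Schwarz bounds
    the cost of [t I] from below uniformly in [u]. *)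
Lemma not_range_growth :
  (forall S0, col_mx A C <> col_mx B D *m S0) ->
  exists x, x != 0 /\ exists2 d, 0 < d &
    forall t, 0 < t -> t * d <= bform (F t%:M) x x.
Proof.
move=> nS; set M := col_mx A C; set L := col_mx B D.
have : ~~ (M^T <= L^T)%MS.
  apply/negP => /submxP[T E]; apply: (nS T^T).
  by rewrite -[col_mx A C]trmxK -/M E trmx_mul trmxK.
rewrite submxE; set coL := cokermx L^T => MZ.
have [j zj] : exists j, col j (M^T *m coL) != 0.
  apply/existsP; apply: contraR MZ => /existsPn H; apply/eqP/matrixP => i j.
  by have := H j; rewrite negbK => /eqP/matrixP/(_ i 0); rewrite !mxE.
pose z := col j coL.
have Mz : M^T *m z != 0 by rewrite /z colE mulmxA -colE.
have Lz : L^T *m z = 0 by rewrite /z colE mulmxA mulmx_coker mul0mx.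
move: Mz; move Ex : (M^T *m z) => x x0.
exists x; split=> //.
have g0 : 0 < bform 1%:M x x by apply: pd_form_gt0 => //; exact: scalar_pd.
have I1 : psd_set (1%:M : 'M[K]_(n + n)).
  split=> [|y]; first exact: tr_scalar_mx.
  by rewrite -/(bform _ _ _) bform1 sumr_ge0 // => i _; rewrite sqr_ge0.
have zw u : bform 1%:M z (M *m x + L *m u) = bform 1%:M x x.
  rewrite bformDr !bform_mulr mul1mx mul1mx.
  have -> : bform L z u = 0.
    by rewrite bform_tr /bform -mulmxA Lz mulmx0 mxE.
  by rewrite addr0 bform_tr -[M^T]mul1mx -bform_mulr Ex.
have cs u : bform 1%:M x x ^+ 2 <= bform 1%:M z z *
     bform 1%:M (M *m x + L *m u) (M *m x + L *m u).
  by have := cauchy_schwarz_psd z (M *m x + L *m u) I1; rewrite zw.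
have z0 : 0 < bform 1%:M z z.
  rewrite lt_neqAle psd_form_ge0 // andbT; apply/eqP => z0.
  by have := cs 0; rewrite -z0 mul0r real_leNgt ?num_real // exprn_gt0.
exists (bform 1%:M x x ^+ 2 / bform 1%:M z z).
  by rewrite divr_gt0 ?exprn_gt0.
move=> t t0; have pt := @pd_psd _ n _ (scalar_pd t0).
have [u E] := riccati_cost_attained A C B D Q Rpd x pt; rewrite E.
rewrite /stage_cost -[t%:M]scalemx1 !bformZ.
have q0 := psd_form_ge0 x (pd_psd Qpd); have r0 := psd_form_ge0 u (pd_psd Rpd).
have csu := cs u.
have Ecol : bform 1%:M (M *m x + L *m u) (M *m x + L *m u) =
   bform 1%:M (A *m x + B *m u) (A *m x + B *m u)
  + bform 1%:M (C *m x + D *m u) (C *m x + D *m u).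
  rewrite !mul_col_mx add_col_mx !bform1 big_split_ord /=.
  by congr (_ + _); apply: eq_bigr => i _; rewrite ?col_mxEu ?col_mxEd.
rewrite -mulrDr -Ecol -addrA; apply: ler_wpDr; first exact: addr_ge0.
by rewrite ler_wpM2l ?(ltW t0) // ler_pdivrMr // mulrC.
Qed.

Lemma Lip_lt1_range : (Lip F (@pd_set K n) < 1)%E ->
  exists S0, col_mx A C = col_mx B D *m S0.
Proof.
move=> L1; apply: contrapT => nS.
have [|x [x0 [d d0 H]]] := not_range_growth.
  by move=> S0 E; apply: nS; exists S0.
apply: growth_Lip_ge1 x0 d0 H L1 => P /pd_psd; exact: riccati_pd.
Qed.

End Necessity.

(** * Lipschitz constants of the Riccati operator *)

Theorem proposition5p10 (K : realType) (n m : nat) (n_gt0 : (0 < n)%N)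
    (A C : 'M[K]_n) (B D : 'M[K]_(n, m)) (Q : 'M[K]_n) (R : 'M[K]_m)
    (Qpd : pd_set Q) (Rpd : pd_set R) :
  (Lip (riccati A C B D Q R) (@pd_set K n) <= 1)%E
  /\
  forall (r : nat) (Bb Db : 'M[K]_(n, r)) (W : 'M[K]_(r, m)),
    rank_factorization (col_mx B D) (col_mx Bb Db) W ->
    ((Lip (riccati A C B D Q R) (@pd_set K n) < 1)%E <->
       exists S : 'M[K]_(r, n), col_mx A C = col_mx Bb Db *m S)
    /\
    forall S : 'M[K]_(r, n), col_mx A C = col_mx Bb Db *m S ->
      let Rb := invmx (W *m invmx R *m W^T) in
      let mu := M_ratio (S^T *m Rb *m S) Q in
      (Lip (riccati A C B D Q R) (@pd_set K n)
         <= (mu / (1 + Num.sqrt (1 + mu)) ^+ 2)%:E)%E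
      /\ mu / (1 + Num.sqrt (1 + mu)) ^+ 2 < 1.
Proof.
split; first exact: Lip_riccati_le1.
move=> r Bb Db W [BD _ Wfree].
have bound S : col_mx A C = col_mx Bb Db *m S ->
    let mu := M_ratio (S^T *m invmx (W *m invmx R *m W^T) *m S) Q in
    (Lip (riccati A C B D Q R) (@pd_set K n) <= (rate mu)%:E)%E /\ rate mu < 1.
  move: BD; rewrite !mul_col_mx => /eq_col_mx[-> ->] /eq_col_mx[-> ->] mu.
  have [mu0 Lmu] := Lip_riccati_le_rate Bb Db S Qpd Rpd Wfree n_gt0.
  by split; last exact: rate_lt1.
split; last exact: bound.
split=> [/(Lip_lt1_range Qpd Rpd)[S0 ->]|[S /bound[Lmu mu1]]].
  by exists (W *m S0); rewrite BD mulmxA.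
by apply: (le_lt_trans Lmu); rewrite lte_fin.
Qed.
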